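(* Let $\mathcal A$ and $\mathcal B$ be ideals of closed subsets of a topological space $X$. If $X$ is functionally $\mathcal A$-normal and $\mathcal B$ consists of sequentially compact sets, then $$\begin{aligned}\mathsf G_1(\mathscr N_X[\mathcal A], \neg \mathcal O_X(\mathcal B)) &\equiv \mathsf G_1(\mathscr N_{MU_{\mathcal A}(X),\mathbf 0}, \neg \Omega_{MU_{\mathcal B}(X),\mathbf 0}) \equiv \mathsf G_1(\mathscr N_{C_{\mathcal A}(X),\mathbf 0}, \neg \Omega_{C_{\mathcal B}(X),\mathbf 0})\\ &\equiv \mathsf G_1(\mathscr T_{MU_{\mathcal A}(X)}, \neg \Omega_{MU_{\mathcal B}(X),\mathbf 0}) \equiv \mathsf G_1(\mathscr T_{C_{\mathcal A}(X)}, \neg \Omega_{C_{\mathcal B}(X),\mathbf 0})\\ &\equiv \mathsf G_1(\mathscr{T}_{MU_{\mathcal A}(X)}, \mathrm{CD}_{MU_{\mathcal B}(X)}) \equiv \mathsf G_1(\mathscr{T}_{C_{\mathcal A}(X)}, \mathrm{CD}_{C_{\mathcal B}(X)}).\end{aligned}$$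
   Context: Games. For collections $\mathcal P,\mathcal Q$ of sets, in the game $\mathsf G_1(\mathcal P,\mathcal Q)$, at round $n\in\omega$ One chooses $P_n\in\mathcal P$ and Two responds with $x_n\in P_n$; Two wins if $\{x_n:n\in\omega\}\in\mathcal Q$, otherwise One wins. $\neg\mathcal Q$ denotes the collection of sets not in $\mathcal Q$. A strategy for One is $\sigma:(\bigcup\mathcal P)^{<\omega}\to\mathcal P$; it is winning if $\{x_n:n\in\omega\}\notin\mathcal Q$ whenever $x_n\in\sigma\langle x_k:k<n\rangle$ for all $n$; $\mathrm I\uparrow$ means One has a winning strategy. A strategy for Two is $\tau:\mathcal P^{<\omega}\to\bigcup\mathcal P$ (giving legal moves); it is winning if $\{\tau(P_0,\dots,P_n):n\in\omega\}\in\mathcal Q$ for all $(P_n)\in\mathcal P^\omega$; $\mathrm{II}\uparrow$ means Two has a winning strategy. A predetermined strategy for One is a function $\omega\to\mathcal P$ (depends only on the round); $\mathrm I\underset{\mathrm{pre}}{\uparrow}$ means One has a winning one. A Markov strategy for Two is a function $\mathcal P\times\omega\to\bigcup\mathcal P$ (depends only on One's latest move and the round); $\mathrm{II}\underset{\mathrm{mark}}{\uparrow}$ means Two has a winning one. Games $\mathcal G,\mathcal H$ are equivalent, $\mathcal G\equiv\mathcal H$, if $\mathrm{II}\underset{\mathrm{mark}}{\uparrow}\mathcal G\Leftrightarrow\mathrm{II}\underset{\mathrm{mark}}{\uparrow}\mathcal H$; $\mathrm{II}\uparrow\mathcal G\Leftrightarrow\mathrm{II}\uparrow\mathcal H$;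 $\mathrm I\not\uparrow\mathcal G\Leftrightarrow\mathrm I\not\uparrow\mathcal H$; and $\mathrm I\underset{\mathrm{pre}}{\not\uparrow}\mathcal G\Leftrightarrow\mathrm I\underset{\mathrm{pre}}{\not\uparrow}\mathcal H$. Ideals and covers. An ideal of closed subsets of $X$ is a family $\mathcal A$ of non-empty closed subsets of $X$, closed under unions of two members and containing $\{x\}$ for every $x\in X$; throughout, $X\notin\mathcal A$ is assumed for every ideal of closed sets. $X$ is functionally $\mathcal A$-normal if for every $A\in\mathcal A$ and open $U\supseteq A$ there is a continuous $f:X\to\mathbb R$ with $f[A]=\{0\}$ and $f[X\setminus U]=\{1\}$ (i.e. $f=1$ on $X\setminus U$). A subset $B$ of a space is sequentially compact if every sequence in $B$ has a subsequence converging to a point of $B$. $\mathcal O_X(\mathcal A)$ is the set of $\mathcal A$-covers: open covers $\mathscr U$ of $X$ with $\emptyset,X\notin\mathscr U$ such that every $A\in\mathcal A$ is contained in some $U\in\mathscr U$. For a space $Z$: $\mathscr T_Z$ is the family of proper non-empty open subsets of $Z$; $\mathscr N_{Z,z}=\{U\in\mathscr T_Z:z\in U\}$; $\mathscr N_Z(A)=\{U\in\mathscr T_Z:A\subseteq U\}$; $\mathscr N_Z[\mathcal A]=\{\mathscr N_Z(A):A\in\mathcal A\}$; $\Omega_{Z,z}=\{S\subseteq Z: z\in\mathrm{cl}(S)\}$; $\mathrm{CD}_Z$ is the set of closed discrete subsets of $Z$. Minimal usco maps. An usco map $\Phi$ from $X$ to $\mathbb R$ assigns to each $x\in X$ a non-empty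 compact set $\Phi(x)\subseteq\mathbb R$ so that $\{x:\Phi(x)\subseteq V\}$ is open for every open $V\subseteq\mathbb R$; it is minimal if its graph $\{(x,y):y\in\Phi(x)\}$ is $\subseteq$-minimal among graphs of usco maps from $X$ to $\mathbb R$. $MU(X)$ is the set of minimal usco maps from $X$ to $\mathbb R$. For $\Phi\in MU(X)$, $A\subseteq X$, $\varepsilon>0$, $[\Phi;A,\varepsilon]$ is the set of $\Psi\in MU(X)$ such that for all $x\in A$ each point of $\Phi(x)$ is within distance $<\varepsilon$ of some point of $\Psi(x)$ and each point of $\Psi(x)$ is within distance $<\varepsilon$ of some point of $\Phi(x)$. $MU_{\mathcal A}(X)$ is $MU(X)$ with the topology in which $O$ is open iff for each $\Phi\in O$ there are $A\in\mathcal A$, $\varepsilon>0$ with $[\Phi;A,\varepsilon]\subseteq O$. $C_{\mathcal A}(X)$ is the set of continuous functions $X\to\mathbb R$ with the topology of uniform convergence on members of $\mathcal A$ (basic neighborhoods of $f$: $\{g:|f(x)-g(x)|<\varepsilon\ \forall x\in A\}$, $A\in\mathcal A$, $\varepsilon>0$). $\mathbf 0$ denotes the constant map $x\mapsto\{0\}$ in $MU(X)$ and the constant function $0$ in $C_{\mathcal A}(X)$. *)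

(* Defs.v *)
From HB Require Import structures.
From mathcomp Require Import all_boot all_order all_algebra.
From mathcomp Require Import all_classical all_reals all_analysis.
Import Order.TTheory GRing.Theory Num.Theory.
Import numFieldNormedType.Exports.

Set Implicit Arguments.
Unset Strict Implicit.
Unset Printing Implicit Defensive.

Local Open Scope classical_set_scope.
Local Open Scope ring_scope.

(** * Selection games *)

(* [One_moves] is the collection P of the legal moves of One, and Two, who has
   to produce a set in the collection Q, picks points of the sets in P. *)
Record game := G1 {
  point : Type;
  One_moves : set (set point);
  Two_target : set (set point) }.
Arguments One_moves : clear implicits.
Arguments Two_target : clear implicits.

Section Strategies.
Variable G : game.
Local Notation T := (point G).
Local Notation P := (One_moves G).
Local Notation Q := (Two_target G).
Local Notation cupP := (\bigcup_(M in P) M).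

(* A function on the finite sequences of elements of [cupP] (or of [P]) is
   encoded by a function on all the finite sequences, whose values outside of
   this domain are irrelevant. *)
Definition strategy_One (sigma : seq T -> set T) : Prop :=
  forall s : seq T, all (mem cupP) s -> P (sigma s).

Definition I_wins : Prop :=
  exists2 sigma : seq T -> set T, strategy_One sigma &
    forall x : nat -> T, (forall n, sigma (mkseq x n) (x n)) -> ~ Q (range x).

Definition strategy_Two (tau : seq (set T) -> T) : Prop :=
  (forall s : seq (set T), all (mem P) s -> cupP (tau s)) /\
  (forall (s : seq (set T)) (M : set T),
     all (mem P) s -> P M -> M (tau (rcons s M))).

Definition II_wins : Prop :=
  exists2 tau : seq (set T) -> T, strategy_Two tau &
    forall p : nat -> set T, (forall n, P (p n)) ->
      Q (range (fun n => tau (mkseq p n.+1))).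

Definition I_wins_pre : Prop :=
  exists2 sigma : nat -> set T, (forall n, P (sigma n)) &
    forall x : nat -> T, (forall n, sigma n (x n)) -> ~ Q (range x).

Definition II_wins_mark : Prop :=
  exists2 tau : set T -> nat -> T, (forall M n, P M -> M (tau M n)) &
    forall p : nat -> set T, (forall n, P (p n)) ->
      Q (range (fun n => tau (p n) n)).

End Strategies.

Definition game_equiv (G H : game) : Prop :=
  [/\ II_wins_mark G <-> II_wins_mark H,
      II_wins G <-> II_wins H,
      ~ I_wins G <-> ~ I_wins H &
      ~ I_wins_pre G <-> ~ I_wins_pre H].

Notation "G ≡ H" := (game_equiv G H) (at level 70, no associativity).

(** * Ideals of closed sets, covers, and families attached to a space *)

Record closed_ideal (X : topologicalType) := ClosedIdeal {
  in_ideal :> set X -> Prop;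
  ideal_closed : forall A, in_ideal A -> closed A;
  ideal_neq0 : forall A, in_ideal A -> A !=set0;
  ideal_setU : forall A B, in_ideal A -> in_ideal B -> in_ideal (A `|` B);
  ideal_set1 : forall x : X, in_ideal [set x];
  ideal_proper : ~ in_ideal [set: X] }.

Definition functionally_normal (R : realType) (X : topologicalType)
    (I : closed_ideal X) : Prop :=
  forall A U : set X, I A -> open U -> A `<=` U ->
    exists f : X -> R, [/\ continuous f,
      forall x, A x -> f x = 0 & forall x, ~ U x -> f x = 1].

Definition sequentially_compact (X : topologicalType) (B : set X) : Prop :=
  forall u : nat -> X, (forall n, B (u n)) ->
    exists2 phi : nat -> nat, {homo phi : m n / (m < n)%N} &
      exists2 b : X, B b & (u \o phi) n @[n --> \oo] --> b.

Definition ideal_covers (X : topologicalType) (I : closed_ideal X) :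
    set (set (set X)) :=
  [set C | [/\ forall U, C U -> open U,
               \bigcup_(U in C) U = [set: X],
               ~ C set0, ~ C [set: X] &
               forall A, I A -> exists2 U, C U & A `<=` U]].

Definition proper_opens (Z : topologicalType) : set (set Z) :=
  [set U | [/\ open U, U !=set0 & U <> [set: Z]]].

Definition nbhds_pt (Z : topologicalType) (z : Z) : set (set Z) :=
  [set U | proper_opens U /\ U z].

Definition nbhds_set (Z : topologicalType) (A : set Z) : set (set Z) :=
  [set U | proper_opens U /\ A `<=` U].

Definition nbhds_ideal (Z : topologicalType) (I : closed_ideal Z) :
    set (set (set Z)) :=
  [set nbhds_set A | A in (I : set (set Z))].

Definition Omega (Z : topologicalType) (z : Z) : set (set Z) :=
  [set S | closure S z].

Definition closed_discrete (Z : topologicalType) : set (set Z) :=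
  [set S | closed S /\ isolated S = S].
Arguments closed_discrete : clear implicits.
Arguments proper_opens : clear implicits.

(** * Minimal usco maps *)

Section Usco.
Variables (R : realType) (X : topologicalType).

Definition usco (F : X -> set R) : Prop :=
  [/\ forall x, F x !=set0, forall x, compact (F x) &
      forall V : set R, open V -> open [set x | F x `<=` V]].

Definition graph (F : X -> set R) : set (X * R) := [set p | F p.1 p.2].

Definition minimal_usco (F : X -> set R) : Prop :=
  usco F /\
  forall G : X -> set R, usco G -> graph G `<=` graph F -> graph G = graph F.

Record MU := MkMU { mu_map :> X -> set R ; mu_minimal : minimal_usco mu_map }.

HB.instance Definition _ := gen_eqMixin MU.
HB.instance Definition _ := gen_choiceMixin MU.

Definition MU_ball (F : MU) (A : set X) (e : R) : set MU :=
  [set G : MU | forall x, A x ->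
     (forall y, F x y -> exists2 z, G x z & `|y - z| < e) /\
     (forall z, G x z -> exists2 y, F x y & `|z - y| < e)].

Lemma minimal_usco0 : minimal_usco (fun=> [set 0]).
Proof.
split.
- split=> [x|x|V oV]; [by exists 0|exact: compact_set1|].
  have [V0|nV0] := pselect (V 0).
    rewrite (_ : [set _ | _] = setT); first exact: openT.
    by apply/seteqP; split=> // x _ _ ->.
  rewrite (_ : [set _ | _] = set0); first exact: open0.
  by apply/seteqP; split=> // x /(_ 0 erefl).
- move=> G [G0 _ _] GF; apply/seteqP; split=> // -[x y] y0.
  have [z Gz] := G0 x.
  have z0 : z = 0 := GF (x, z) Gz.
  by rewrite /graph /= (y0 : y = 0) -z0.
Qed.

Definition MU0 : MU := MkMU minimal_usco0.

End Usco.

(* MU_I(X): the set MU(X) with its topology induced by the ideal I. *)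
Definition MU_space (R : realType) (X : topologicalType) (I : closed_ideal X)
  : Type := MU R X.

Section MU_topology.
Variables (R : realType) (X : topologicalType) (I : closed_ideal X).
Local Notation Z := (MU_space R I).

HB.instance Definition _ := Choice.on Z.

(* The disjunct [O = setT] only matters if X, hence I, is empty: see
   [MU_openP]. *)
Definition MU_open : set (set Z) :=
  [set O | O = setT \/
     forall F, O F ->
       exists2 A, I A & exists2 e : R, 0 < e & MU_ball F A e `<=` O].

Let MU_openT : MU_open setT. Proof. by left. Qed.

Let MU_openI : setI_closed MU_open.
Proof.
move=> O O' [->|hO]; first by rewrite setTI.
move=> [->|hO']; first by rewrite setIT; right.
right=> F [/hO [A IA [e e0 sO]] /hO' [A' IA' [e' e'0 sO']]].
exists (A `|` A'); first exact: ideal_setU.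
exists (Num.min e e'); first by rewrite lt_min e0.
move=> G hG; split; [apply: sO|apply: sO'] => x Ax;
  have [h1 h2] := hG x ltac:(by [left|right]).
- split=> y Hy; [have [z ? +] := h1 y Hy|have [z ? +] := h2 y Hy];
    by rewrite lt_min => /andP[? ?]; exists z.
- split=> y Hy; [have [z ? +] := h1 y Hy|have [z ? +] := h2 y Hy];
    by rewrite lt_min => /andP[? ?]; exists z.
Qed.

Let MU_open_bigU (J : Type) (f : J -> set Z) :
  (forall i, MU_open (f i)) -> MU_open (\bigcup_i f i).
Proof.
move=> hf; have [[i fi]|nT] := pselect (exists i, f i = setT).
  by left; apply/seteqP; split=> // x _; exists i; rewrite // fi.
right=> F [i _ fiF]; have [fi|hi] := hf i; first by case: nT; exists i.
have [A IA [e e0 sub]] := hi F fiF.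
by exists A => //; exists e => // G /sub; exists i.
Qed.

HB.instance Definition _ :=
  isOpenTopological.Build Z MU_openT MU_openI MU_open_bigU.

Lemma MU_openP (x0 : X) (O : set Z) :
  open O <-> forall F, O F ->
    exists2 A, I A & exists2 e : R, 0 < e & MU_ball F A e `<=` O.
Proof.
split=> [oO F OF|hO].
  have : nbhs F O by exact: open_nbhs_nbhs.
  case=> [V [[->|hV] VF VO]].
    exists [set x0]; first exact: ideal_set1.
    by exists 1 => // G _; apply: VO.
  have [A IA [e e0 sub]] := hV F VF.
  by exists A => //; exists e => //; exact: subset_trans VO.
rewrite openE => F OF; exists O; split=> //.
by right.
Qed.

End MU_topology.

(** * Continuous functions *)

(* C_I(X): [{family I, X -> R}] is the set of all the functions X -> R with the
   topology of uniform convergence on the members of I; its restriction to the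
   continuous functions is described in [C_nbhsP]. *)
Definition C_space (R : realType) (X : topologicalType) (I : closed_ideal X)
  : Type := continuousType X R.

Section C_topology.
Variables (R : realType) (X : topologicalType) (I : closed_ideal X).
Local Notation Z := (C_space R I).

HB.instance Definition _ := Topological.copy Z
  (initial_topology (fun f : continuousType X R => f : {family I, X -> R})).

Lemma C_nbhsP (x0 : X) (f : Z) (N : set Z) :
  nbhs f N <-> exists2 A, I A & exists2 e : R, 0 < e &
    [set g : Z | forall x, A x -> `|(f : X -> R) x - (g : X -> R) x| < e]
      `<=` N.
Proof.
pose b (h : X -> R) (p : set X * R) : set (X -> R) :=
  [set g | forall x, p.1 x -> `|h x - g x| < p.2].
pose D : set (set X * R) := [set p | I p.1 /\ 0 < p.2].
have bF (h : X -> R) : Filter (filter_from D (b h)).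
  apply: filter_from_filter; first by exists ([set x0], 1); split=> //=;
    exact: ideal_set1.
  move=> [A e] [A' e'] [/= IA e0] [/= IA' e'0].
  exists (A `|` A', Num.min e e').
    by split=> /=; [exact: ideal_setU|rewrite lt_min e0].
  move=> g hg; split=> x /= Ax.
    by have := hg x (or_introl Ax); rewrite /= lt_min => /andP[].
  by have := hg x (or_intror Ax); rewrite /= lt_min => /andP[].
have famP (h : {family I, X -> R}) (M : set {family I, X -> R}) :
    nbhs h M <-> filter_from D (b h) M.
  split=> [hM|[[A e] [/= IA e0] sub]].
    have : {family I, filter_from D (b h) --> (h : X -> R)}.
      apply/fam_cvgP => A IA P /uniform_nbhs[E [entE sub]].
      move: entE; rewrite -entourage_ballE => -[e /= e0 eE].
      by exists (A, e) => // g hg; apply: sub => x Ax; apply: eE; exact: hg.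
    by apply.
  have hb : nbhs h (b h (A, e) : set {family I, X -> R}).
    apply: (@fam_nbhs X R I A [set p | ball p.1 e p.2] h) => //.
    by rewrite -entourage_ballE; exists e.
  exact: (@filterS _ (nbhs h) _ _ _ sub hb).
split.
- case=> O [[W oW <-] Wf sub].
  have : nbhs ((f : X -> R) : {family I, X -> R}) W by exact: open_nbhs_nbhs.
  move=> /famP[[A e] [/= IA e0] WA].
  by exists A => //; exists e => // g hg; apply: sub; exact: WA.
- case=> A IA [e e0 sub].
  have : nbhs ((f : X -> R) : {family I, X -> R}) (b f (A, e)).
    by apply/famP; exists (A, e).
  rewrite nbhsE => -[W [oW Wf] WA].
  exists ((fun g : Z => (g : X -> R)) @^-1` W); split=> //; first by exists W.
  by move=> g /WA hg; exact: sub.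
Qed.

End C_topology.

Section C_zero.
Variables (R : realType) (X : topologicalType).

Let cst0_continuous : continuous (fun _ : X => 0 : R).
Proof. by move=> x; exact: cst_continuous. Qed.

Definition C0 : continuousType X R := mkcts cst0_continuous.

End C_zero.

(* Main.v *)
Require Import Defs.
From mathcomp Require Import all_boot all_order all_algebra.
From mathcomp Require Import all_classical all_reals all_analysis.
From mathcomp Require Import lra.
Import Order.TTheory GRing.Theory Num.Theory.
Import numFieldNormedType.Exports.

Set Implicit Arguments.
Unset Strict Implicit.
Unset Printing Implicit Defensive.

Local Open Scope classical_set_scope.

(** Write [G <= H] when Two does at least as well in [H] as in [G], for each of
    the four kinds of strategies.  Everything rests on one way to get [G <= H]
    ([game_le_translation]): in every round, a move of One in [H] is answered by
    a move of One in [G], and a reply of Two to the latter is turned into a reply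
    to the former, so that runs of [G] won by Two become runs of [H] won by Two.

    The continuous functions and the minimal usco maps are treated at once.  All
    that matters is a set [E] of usco maps that contains the map [0] and is
    stable under fibrewise images [F |-> phi(x, F x)] by continuous [phi], with
    the topologies given by the Hausdorff distance on the members of an ideal
    ([usco_space]).  Minimal usco maps are stable in this way because minimality
    is a kind of quasicontinuity ([minimal_uscoP]).

    For such an [E] the games are compared along the cycle
      covers <= closed discrete sets <= points off the closure, open moves
             <= points off the closure, neighbourhoods of 0 <= covers.
    - In the first step One plays an open set around some [F], containing all the
      maps uniformly close to [F] on some [S] in [A].  This becomes the move [S]
      in the game of covers.  Two replies with an open set [U] containing [S], and
      by normality there is [G] in [E] equal to [F] on [S] and to the constant
      [n], the number of the round, outside of [U].  If the [U]'s are not a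
      [B]-cover, some [T] in [B] lies in none of them, so the [n]-th map takes
      the value [n] somewhere on [T].  A map of [E] is bounded on the sequentially
      compact set [T], so it is near only finitely many of the maps played, which
      therefore form a closed discrete set.
    - In the second step One removes [0] from the open set: a closed set missing
      [0] does not have [0] in its closure.
    - In the third step One has fewer moves in the last of the two games.
    - In the last step the move [S] becomes the set of the maps of modulus less
      than [1/(n+1)] on [S]; from the reply [F], Two gets the open set where [F]
      is of modulus less than [1/(n+1)], minus one point.  If these sets are a
      [B]-cover, each [T] in [B] lies in one of them of arbitrarily large index
      ([ideal_covers_late]), so [0] is in the closure of the maps played.

    When [X] is empty no game has a legal move, which is treated apart. *)

(** * Comparison of games *)

Definition game_le (G H : game) : Prop :=
  [/\ II_wins_mark G -> II_wins_mark H, II_wins G -> II_wins H,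
      I_wins H -> I_wins G & I_wins_pre H -> I_wins_pre G].

Lemma game_equiv_sym (G H : game) : G ≡ H -> H ≡ G.
Proof. by move=> [? ? ? ?]; split; tauto. Qed.

Lemma game_equiv_trans (G H K : game) : G ≡ H -> H ≡ K -> G ≡ K.
Proof. by move=> [? ? ? ?] [? ? ? ?]; split; tauto. Qed.

Lemma game_le_trans (G H K : game) : game_le G H -> game_le H K -> game_le G K.
Proof. by move=> [a b c d] [a' b' c' d']; split; tauto. Qed.

Lemma game_le_equiv (G H : game) : game_le G H -> game_le H G -> G ≡ H.
Proof. by move=> [a b c d] [a' b' c' d']; split; tauto. Qed.

(** The relation [W n x y] records what the translation of the reply [x] in
    round [n] into [y] guarantees.  The first hypothesis is needed since a
    strategy has values at all sequences: they must be moves of [H] even at the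
    empty sequence, or after plays that the translation does not produce. *)
Lemma game_le_translation (G H : game)
    (W : nat -> Defs.point G -> Defs.point H -> Prop) :
  \bigcup_(M in One_moves H) M !=set0 ->
  (forall n M, One_moves H M -> exists2 N, One_moves G N &
     forall x, N x -> exists2 y, M y & W n x y) ->
  (forall x y, (forall n, W n (x n) (y n)) ->
     Two_target G (range x) -> Two_target H (range y)) ->
  game_le G H.
Proof.
move=> [d cupd] move_back win_forth.
have /choice[tI tIP] : forall nM : nat * set (Defs.point H),
    exists N, One_moves H nM.2 -> One_moves G N /\
      forall x, N x -> exists2 y, nM.2 y & W nM.1 x y.
  move=> [n M] /=.
  have [/(move_back n)[N GN NM]|nHM] := pselect (One_moves H M).
    by exists N.
  by exists set0.
have /choice[tII tIIP] : forall nMx : nat * set (Defs.point H) *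
      Defs.point G, exists y, One_moves H nMx.1.2 -> tI nMx.1 nMx.2 ->
      nMx.1.2 y /\ W nMx.1.1 nMx.2 y.
  move=> [[n M] x] /=.
  have [HM|nHM] := pselect (One_moves H M); last by exists d.
  have [Nx|nNx] := pselect (tI (n, M) x); last by exists d.
  by have [_ /(_ x Nx)[y My Wy]] := tIP (n, M) HM; exists y.
split.
- move=> [tau tauP tauW]; exists (fun M n => tII (n, M, tau (tI (n, M)) n)).
    move=> M n HM; have [GN _] := tIP (n, M) HM.
    by have [] := tIIP (n, M, tau (tI (n, M)) n) HM (tauP _ _ GN).
  move=> p Hp; pose q n := tI (n, p n).
  have Gq n : One_moves G (q n) by have [] := tIP (n, p n) (Hp n).
  apply: (win_forth (fun n => tau (q n) n)); last exact: tauW.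
  move=> n; have qx : tI (n, p n) (tau (q n) n) by exact: tauP.
  by have [] := tIIP (n, p n, tau (q n) n) (Hp n) qx.
- move=> [tau [tau1 tau2] tauW].
  (* The moves of One in [G] that answer the moves [s] of One in [H] *)
  pose trans s := mkseq (fun i => tI (i, nth set0 s i)) (size s).
  have transP s : all (mem (One_moves H)) s ->
      all (mem (One_moves G)) (trans s).
    move=> /(all_nthP set0) Hs; apply/(all_nthP set0) => i.
    rewrite size_mkseq => ils; rewrite nth_mkseq //; apply/mem_set.
    by have [] := tIP (i, nth set0 s i) (set_mem (Hs i ils)).
  have trans_rcons s M : trans (rcons s M) = rcons (trans s) (tI (size s, M)).
    rewrite /trans size_rcons mkseqS nth_rcons ltnn eqxx; congr rcons.
    apply/eq_in_map => i; rewrite mem_iota /= add0n => ils.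
    by rewrite nth_rcons ils.
  pose tau' s := if s is [::] then d else
    tII ((size s).-1, last set0 s, tau (trans s)).
  have tau'E s M : tau' (rcons s M) =
      tII (size s, M, tau (rcons (trans s) (tI (size s, M)))).
    rewrite -trans_rcons /tau'; case E : (rcons s M) => [|M' s'].
      by case: s E.
    by rewrite -E size_rcons last_rcons.
  have legal s M : all (mem (One_moves H)) s -> One_moves H M ->
      M (tau' (rcons s M)) /\
      W (size s) (tau (trans (rcons s M))) (tau' (rcons s M)).
    move=> Hs HM; rewrite trans_rcons tau'E.
    have [GN _] := tIP (size s, M) HM.
    have tx := tau2 _ _ (transP s Hs) GN.
    exact: (tIIP (size s, M, tau (rcons (trans s) (tI (size s, M)))) HM tx).
  exists tau'.
    split=> [s|s M Hs HM]; last by have [] := legal s M Hs HM.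
    case/lastP: s => [//|s M]; rewrite all_rcons => /andP[/set_mem HM Hs].
    by exists M => //; have [] := legal s M Hs HM.
  move=> p Hp.
  have Hps n : all (mem (One_moves H)) (mkseq p n).
    by apply/allP => M /mapP[i _ ->]; apply/mem_set.
  pose q n := tI (n, p n).
  have transE n : trans (mkseq p n) = mkseq q n.
    rewrite /trans size_mkseq; apply/eq_in_map => i.
    by rewrite mem_iota add0n => /= ilt; rewrite nth_mkseq.
  apply: (win_forth (fun n => tau (mkseq q n.+1))).
    move=> n; rewrite -transE mkseqS.
    by have [_] := legal _ _ (Hps n) (Hp n); rewrite size_mkseq.
  by apply: tauW => n; have [] := tIP (n, p n) (Hp n).
- move=> [sigma sigmaP sigmaW].
  (* The history of the play in [H] is rebuilt from that of [G].  Since [x] may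
     be an illegal reply, its translation is clipped to the points of [H]. *)
  pose clip y := if pselect ((\bigcup_(M in One_moves H) M) y) then y else d.
  have clipP y : (\bigcup_(M in One_moves H) M) (clip y).
    by rewrite /clip; case: pselect.
  pose step ys x := rcons ys (clip (tII (size ys, sigma ys, x))).
  pose hist := foldl step [::].
  have histS s x : hist (rcons s x) = step (hist s) x.
    by rewrite /hist -cats1 foldl_cat.
  have size_hist s : size (hist s) = size s.
    by elim/last_ind: s => // s x IH; rewrite histS !size_rcons IH.
  have Hhist s : One_moves H (sigma (hist s)).
    apply: sigmaP; elim/last_ind: s => // s x IH.
    by rewrite histS all_rcons IH andbT; apply/mem_set/clipP.
  exists (fun s => tI (size s, sigma (hist s))).
    by move=> s _; have [] := tIP (size s, sigma (hist s)) (Hhist s).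
  move=> x x_legal.
  have xP n : tI (n, sigma (hist (mkseq x n))) (x n).
    by have := x_legal n; rewrite size_mkseq.
  pose y n := tII (n, sigma (hist (mkseq x n)), x n).
  have yP n := tIIP (n, sigma (hist (mkseq x n)), x n) (Hhist _) (xP n).
  have histE n : hist (mkseq x n) = mkseq y n.
    elim: n => // n IH; rewrite mkseqS histS /step size_hist size_mkseq.
    rewrite -/(y n) mkseqS IH; congr rcons; rewrite /clip; case: pselect => //.
    by case; exists (sigma (hist (mkseq x n))) => //; have [] := yP n.
  move=> Gx; apply: (sigmaW y) => [n|].
    by rewrite -histE; have [] := yP n.
  by apply: (win_forth x) => // n; have [] := yP n.
- move=> [sigma sigmaP sigmaW]; exists (fun n => tI (n, sigma n)).
    by move=> n; have [] := tIP (n, sigma n) (sigmaP n).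
  move=> x xP; pose y n := tII (n, sigma n, x n).
  have yP n := tIIP (n, sigma n, x n) (sigmaP n) (xP n).
  move=> Gx; apply: (sigmaW y) => [n|]; first by have [] := yP n.
  by apply: (win_forth x) => // n; have [] := yP n.
Qed.

(** Two has no strategy at all here, as it would have to pick a point of some
    move of One at the empty sequence; a Markov strategy need not. *)
Lemma game_equiv_no_moves (G H : game) : One_moves G = set0 ->
  One_moves H = set0 -> Defs.point G -> Defs.point H -> G ≡ H.
Proof.
have no_moves K : One_moves K = set0 -> Defs.point K ->
    [/\ II_wins_mark K, ~ II_wins K, ~ I_wins K & ~ I_wins_pre K].
  move=> K0 d; split.
  - by exists (fun=> fun=> d); rewrite K0 // => p /(_ 0%N).
  - by move=> [tau [/(_ [::] isT)[M]]]; rewrite K0.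
  - by move=> [sigma /(_ [::] isT)]; rewrite K0.
  - by move=> [sigma /(_ 0%N)]; rewrite K0.
move=> G0 H0 /(no_moves _ G0)[? ? ? ?] /(no_moves _ H0)[? ? ? ?].
by split; tauto.
Qed.

Local Open Scope ring_scope.

(** * Usco maps *)

Section UscoMaps.
Variables (R : realType) (X : topologicalType).
Implicit Types (F G : X -> set R) (phi : X * R -> R).

Definition fibre_image phi F : X -> set R :=
  fun x => (fun y => phi (x, y)) @` F x.

Lemma fibre_continuous phi x : continuous phi ->
  continuous (fun y => phi (x, y)).
Proof.
move=> cphi y.
apply: (@continuous_comp R (X * R)%type R (fun y => (x, y)) phi y).
  apply: (@cvg_pair _ _ _ (nbhs y) (nbhs x) (nbhs y)); last exact: cvg_id.
  exact: cvg_cst.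
exact: cphi.
Qed.

(** Upper semicontinuity is a tube argument: by compactness of [F x], one
    neighbourhood of [x] and one radius [e] around the points of [F x] are
    mapped into [V] by [phi]. *)
Lemma usco_fibre_image phi F : continuous phi -> usco F ->
  usco (fibre_image phi F).
Proof.
move=> cphi [F0 cF uF]; split=> [x|x|V oV].
- by have [y Fy] := F0 x; exists (phi (x, y)), y.
- apply: continuous_compact => //; apply: continuous_subspaceT.
  exact: fibre_continuous.
- rewrite openE => x /= FxV.
  have [[U E] /= [xU E0] tubeV] : filter_prod (nbhs x) (0 : R)^'+
      [set p | forall y y', F x y -> `|y - y'| < p.2 -> V (phi (p.1, y'))].
    pose P (p : X * R) y := forall y', `|y - y'| < p.2 -> V (phi (p.1, y')).
    have covP := (compact_near_coveringP (F x)).1 (cF x).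
    suff : \forall p \near filter_prod (nbhs x) (0 : R)^'+, F x `<=` P p.
      by apply: filterS => p FP y y' /FP; exact.
    apply: covP => y Fxy.
    have : nbhs (x, y) (phi @^-1` V).
      by apply: cphi; apply: open_nbhs_nbhs; split=> //; apply: FxV; exists y.
    case=> -[U V'] /= [Ux /nbhs_ballP[r /= r0 rV]] UV.
    exists (ball y (r / 2), [set p | U p.1 /\ p.2 < r / 2]) => /=.
      split; first by apply: nbhsx_ballx; rewrite divr_gt0.
      exists (U, [set e | e < r / 2]) => /=; last by [].
      by split=> //; apply: nbhs_right_lt; rewrite divr_gt0.
    move=> [y1 [x1 e]] /= [yy1 [Ux1 er]] y2 /= y12; apply: (UV (x1, y2)).
    split=> //=; apply: rV; rewrite /ball /= in yy1 *.
    have := ler_distD y1 y y2; lra.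
  have [e [Ee e0]] : exists e, E e /\ 0 < e.
    exact: filter_ex (filterI E0 (nbhs_right_gt 0)).
  pose V' := \bigcup_(y in F x) ball y e.
  have oV' : open V' by apply: bigcup_open => y _; exact: ball_open.
  have FxV' : F x `<=` V' by move=> y Fxy; exists y => //; exact: ballxx.
  have xV' : nbhs x [set x' | F x' `<=` V'].
    by apply: open_nbhs_nbhs; split=> //; exact: uF.
  apply: filterS (filterI xU xV') => x' [Ux' Fx'] _ [y' Fy' <-].
  have [y Fy yy'] := Fx' y' Fy'; exact: (tubeV (x', e)) Fy yy'.
Qed.

(** Minimality as quasicontinuity.  If the right-hand side fails for [U] and
    [V], removing [V] from the values of [F] over [U] leaves a smaller usco map.
    Conversely, if [G] omits a point [y] of [F x], then near [x] the values of
    [G] stay away from [y], whereas [F], hence [G], is close to [y] somewhere. *)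
Lemma minimal_uscoP F : usco F ->
  (minimal_usco F <-> forall U V x, open U -> open V -> U x ->
     F x `&` V !=set0 -> exists2 w, U w & F w `<=` V).
Proof.
move=> uscoF; have [F0 cF uF] := uscoF; split.
- move=> [_ minF] U V x oU oV Ux [y [Fxy Vy]].
  apply: contrapT => noW.
  pose G x := F x `\` [set y | U x /\ V y].
  have uscoG : usco G.
    split=> [z|z|V' oV'].
    + apply: contrapT => Gz0; apply: noW.
      have FzV t : F z t -> U z /\ V t.
        by move=> Fzt; apply: contrapT => ?; apply: Gz0; exists t.
      by have [t /FzV[Uz _]] := F0 z; exists z => // s /FzV[].
    + have [Uz|nUz] := pselect (U z); last first.
        rewrite (_ : G z = F z) //; apply/seteqP; split=> [t []//|t Ft].
        by split=> // -[].
      rewrite (_ : G z = F z `&` ~` V).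
        apply: compact_closedI => //; exact: open_closedC.
      apply/seteqP; split=> t [Ft nt]; split=> //.
        by move=> Vt; apply: nt.
      by move=> [].
    + rewrite (_ : [set _ | _] = [set z | F z `<=` V'] `|`
          (U `&` [set z | F z `<=` V' `|` V])).
        by apply: openU; [exact: uF|apply: openI => //; apply/uF/openU].
      apply/seteqP; split=> [z GV'|z [FV' t [/FV']//|[Uz FVV'] t [Ft nt]]].
        have [Uz|nUz] := pselect (U z); [right; split=> // t Ft|left=> t Ft].
          have [Vt|nVt] := pselect (V t); [by right|left].
          by apply: GV'; split=> // -[].
        by apply: GV'; split=> // -[].
      by have [//|Vt] := FVV' t Ft; case: nt.
  have GF : graph G `<=` graph F by move=> p [].
  have : graph F (x, y) by [].
  by rewrite -(minF G uscoG GF) => -[_]; apply.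
- move=> qc; split=> // G [G0 cG uG] GF; apply/seteqP; split=> // -[x y] Fxy.
  apply: contrapT => nGxy.
  have clG : closed (G x).
    by apply: compact_closed (cG x); exact: Rhausdorff.
  have [r r0 rG] : exists2 r, 0 < r & forall z, G x z -> r <= `|y - z|.
    have : nbhs y (~` G x).
      by apply: open_nbhs_nbhs; split=> //; exact: closed_openC.
    move=> /nbhs_ballP[r /= r0 rG]; exists r => // z Gz.
    by rewrite leNgt; apply/negP => yz; exact: (rG z).
  pose V' := \bigcup_(z in G x) ball z (r / 2).
  have oV' : open V' by apply: bigcup_open => z _; exact: ball_open.
  have GV' : G x `<=` V'.
    by move=> z Gz; exists z => //; apply: ballxx; rewrite divr_gt0.
  have Fxr : F x `&` ball y (r / 2) !=set0.
    by exists y; split=> //; apply: ballxx; rewrite divr_gt0.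
  have [w /= GwV' FwV] := qc _ _ _ (uG _ oV') (ball_open y (r / 2)) GV' Fxr.
  have [z Gwz] := G0 w; have [z' Gz' zz'] := GwV' z Gwz.
  have yz := FwV z (GF (w, z) Gwz).
  have := rG z' Gz'; rewrite /ball /= in zz' yz.
  have := ler_distD z y z'; rewrite (distrC z z'); lra.
Qed.

Lemma minimal_usco_fibre_image phi F : continuous phi -> minimal_usco F ->
  minimal_usco (fibre_image phi F).
Proof.
move=> cphi minF; have uscoF := minF.1.
apply/(minimal_uscoP (usco_fibre_image cphi uscoF)) => U V x oU oV Ux.
move=> [_ [[y Fxy <-] Vy]].
have : nbhs (x, y) (phi @^-1` V).
  by apply: cphi; exact: open_nbhs_nbhs.
case=> -[U' V'] /= [U'x V'y] UV.
have [w [Uw U'w] FwV'] : exists2 w, (U `&` U'^°) w & F w `<=` V'^°.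
  apply: ((minimal_uscoP uscoF).1 minF _ _ x) => //.
  - by apply: openI => //; exact: open_interior.
  - exact: open_interior.
  - by exists y.
exists w => // _ [t /FwV' V't <-]; apply: (UV (w, t)).
by split; exact: interior_subset.
Qed.

(** Values of modulus more than [n] over points [x_n] of [B] cannot exist for
    all [n]: near the limit of a subsequence of the [x_n], the map is bounded. *)
Lemma usco_bounded F (B : set X) : usco F -> sequentially_compact B ->
  exists M : R, forall x y, B x -> F x y -> `|y| <= M.
Proof.
move=> [F0 cF uF] seqB; apply: contrapT => unbounded.
have /choice[u uP] n : exists p : X * R,
    [/\ B p.1, F p.1 p.2 & n%:R < `|p.2|].
  apply: contrapT => bounded; apply: unbounded; exists n%:R => x y Bx Fxy.
  by rewrite leNgt; apply/negP => ny; apply: bounded; exists (x, y).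
have uB n : B (u n).1 by have [] := uP n.
have [phi phi_inc [b Bb cvg_b]] := seqB (fst \o u) uB.
have [M [_ Mb]] := compact_bounded (cF b).
pose V : set R := ball 0 (M + 2).
have Vb : nbhs b [set x | F x `<=` V].
  apply: open_nbhs_nbhs; split; first by apply: uF; exact: ball_open.
  move=> y Fby; rewrite /V /ball /= sub0r normrN.
  by have := Mb (M + 1) ltac:(lra) y Fby; rewrite /=; lra.
have [N _ NV] : \forall n \near \oo, F (u (phi n)).1 `<=` V.
  exact: (cvg_b _ Vb).
have phi_ge n : (n <= phi n)%N.
  by elim: n => // n IH; apply: leq_ltn_trans IH (phi_inc _ _ _).
pose n := maxn N (Num.bound (M + 2)).
have [_ Fn ltn] := uP (phi n).
have := NV n (leq_maxl _ _) _ Fn; rewrite /V /ball /= sub0r normrN => yM.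
have Mn : M + 2 < n%:R.
  have [M0|M0] := ltP (M + 2) 0; first exact: lt_le_trans M0 (ler0n _ _).
  apply: lt_le_trans (archi_boundP M0) _.
  by rewrite ler_nat leq_maxr.
have : n%:R <= (phi n)%:R :> R by rewrite ler_nat.
lra.
Qed.

End UscoMaps.

(** All the subsets of the range are closed, by local finiteness. *)
Lemma closed_discrete_locally_finite (Z : topologicalType) (u : nat -> Z) :
  accessible_space Z ->
  (forall z : Z, exists2 N, nbhs z N & finite_set [set n | N (u n)]) ->
  closed_discrete Z (range u).
Proof.
move=> T1 loc_fin.
have closedS S : S `<=` range u -> closed S.
  move=> Su z clSz; apply: contrapT => nSz.
  have [N zN finN] := loc_fin z.
  pose D := u @` [set n | N (u n)] `&` S.
  have finD : finite_set D by apply: finite_setIl; exact: finite_image.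
  have zD : nbhs z (~` D).
    apply: open_nbhs_nbhs; split; last by move=> [].
    by apply: closed_openC; exact: (accessible_finite_set_closed.1 T1).
  have [s [Ss [Ns nDs]]] := clSz _ (filterI zN zD).
  by have [n _ un] := Su s Ss; apply: nDs; split=> //; exists n; rewrite //= un.
split; first exact: closedS.
apply/seteqP; split=> [|z uz]; first exact: isolatedS.
split; first exact/mem_set.
exists (~` (range u `\ z)).
  apply: open_nbhs_nbhs; split; last by move=> [_ /(_ erefl)].
  by apply: closed_openC; apply: closedS; exact: subDsetl.
apply/seteqP; split=> [w [nw uw]|_ ->]; last by split=> // -[_ /(_ erefl)].
by apply: contrapT => wz; apply: nw.
Qed.

(** * Hausdorff distance on a set *)

Section HausdorffBalls.
Variables (R : realType) (X : topologicalType).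
Implicit Types F G H : X -> set R.

Definition hausdorff_near F (A : set X) (e : R) G : Prop :=
  forall x, A x ->
    (forall y, F x y -> exists2 z, G x z & `|y - z| < e) /\
    (forall z, G x z -> exists2 y, F x y & `|z - y| < e).

Lemma hausdorff_near_trans F G H (A : set X) (d e : R) :
  hausdorff_near F A d G -> hausdorff_near G A e H ->
  hausdorff_near F A (d + e) H.
Proof.
move=> FG GH x Ax; have [FG1 FG2] := FG x Ax; have [GH1 GH2] := GH x Ax.
split=> y /=.
- move=> /FG1[z /GH1[t Ht zt] yz]; exists t => //.
  have := ler_distD z y t; lra.
- move=> /GH2[z /FG2[t Ht zt] yz]; exists t => //.
  have := ler_distD z y t; lra.
Qed.

Lemma hausdorff_near0 F (A : set X) (e : R) : (forall x, F x !=set0) ->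
  hausdorff_near (fun=> [set 0]) A e F <->
    forall x y, A x -> F x y -> `|y| < e.
Proof.
move=> F0; split=> [FA x y Ax Fxy|FA x Ax].
  by have [_ /(_ y Fxy)[_ ->]] := FA x Ax; rewrite subr0.
split=> [_ ->|y Fxy]; last by exists 0; rewrite // subr0; exact: FA Fxy.
by have [y Fxy] := F0 x; exists y; rewrite // sub0r normrN; exact: FA Fxy.
Qed.

Lemma hausdorff_near_cst (f g : X -> R) (A : set X) (e : R) :
  hausdorff_near (fun x => [set f x]) A e (fun x => [set g x]) <->
    forall x, A x -> `|f x - g x| < e.
Proof.
split=> [fg x Ax|fg x Ax].
  by have [/(_ _ erefl)[_ ->]] := fg x Ax.
split=> _ ->; first by exists (g x) => //; exact: fg.
by exists (f x) => //; rewrite distrC; exact: fg.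
Qed.

(** This makes the topologies of uniform convergence T1: two usco maps differ
    at some point [x], and their values there are closed. *)
Lemma hausdorff_near_sep F G : usco F -> usco G -> F <> G ->
  exists x, exists2 e : R, 0 < e & ~ hausdorff_near F [set x] e G.
Proof.
move=> [_ cF _] [_ cG _] FG.
have sep (K : set R) y : compact K -> ~ K y ->
    exists2 e, 0 < e & forall z, K z -> e <= `|y - z|.
  move=> /(compact_closed (@Rhausdorff R)) clK nKy.
  have : nbhs y (~` K).
    by apply: open_nbhs_nbhs; split=> //; exact: closed_openC.
  move=> /nbhs_ballP[e /= e0 eK]; exists e => // z Kz.
  by rewrite leNgt; apply/negP => yz; exact: (eK z).
have [x FGx] : exists x, F x <> G x.
  by apply: contrapT => /forallNP FGx; apply: FG; apply/funext => x;
    exact: contrapT (FGx x).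
exists x; apply: contrapT => near_all; apply: FGx; apply/seteqP.
split=> y Hy; apply: contrapT => nHy.
- have [e e0 eG] := sep _ y (cG x) nHy; apply: near_all; exists e => // FGe.
  have [/(_ y Hy)[z /eG + yz] _] := FGe x erefl; lra.
- have [e e0 eF] := sep _ y (cF x) nHy; apply: near_all; exists e => // FGe.
  have [_ /(_ y Hy)[z /eF + yz]] := FGe x erefl; lra.
Qed.

End HausdorffBalls.

(** * Spaces of usco maps *)

(** The topology for an ideal [I] is given as a class on the type [us_sort]
    rather than as a topological space, since the games involve two topologies
    on the same set of points.  The point [x0] in [us_nbhs] rules out an empty
    [X], for which no member of [I] is there to describe neighbourhoods. *)
Record usco_space (R : realType) (X : topologicalType) := UscoSpace {
  us_sort : Type;
  us_val : us_sort -> X -> set R;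
  us_zero : us_sort;
  us_class : closed_ideal X -> Topological.axioms_ us_sort;
  us_usco : forall F, usco (us_val F);
  us_inj : injective us_val;
  us_zeroE : us_val us_zero = fun=> [set 0];
  us_image : forall (phi : X * R -> R) F, continuous phi ->
    exists G, us_val G = fibre_image phi (us_val F);
  us_nbhs : forall (I : closed_ideal X) (x0 : X) F (N : set us_sort),
    @nbhs _ (Topological.Pack (us_class I)) F N <->
    exists2 A, I A & exists2 e, 0 < e &
      [set G | hausdorff_near (us_val F) A e (us_val G)] `<=` N }.

Definition us_top (R : realType) (X : topologicalType) (E : usco_space R X)
  (I : closed_ideal X) : topologicalType := Topological.Pack (us_class E I).

(** * Translations between the games *)

Section Translations.
Variables (R : realType) (X : topologicalType) (E : usco_space R X).
Variables (A B : closed_ideal X) (x0 : X).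
Hypothesis normalA : functionally_normal R A.
Hypothesis seqB : forall S : set X, B S -> sequentially_compact S.

Local Notation Z I := (us_top E I).
Local Notation val := (us_val (u := E)).
Local Notation zero := (us_zero E).

Lemma us_val_neq0 (F : us_sort E) x : val F x !=set0.
Proof. by have [] := us_usco F. Qed.

Lemma us_nbhsP (I : closed_ideal X) (F : us_sort E) (N : set (us_sort E)) :
  nbhs (F : Z I) N <-> exists2 S, I S & exists2 e, 0 < e &
    [set G | hausdorff_near (val F) S e (val G)] `<=` N.
Proof. exact: us_nbhs x0 F N. Qed.

Lemma us_nbhs_near (I : closed_ideal X) (F : us_sort E) S e : I S -> 0 < e ->
  nbhs (F : Z I) [set G | hausdorff_near (val F) S e (val G)].
Proof. by move=> IS e0; apply/us_nbhsP; exists S => //; exists e. Qed.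

Lemma us_open_near (I : closed_ideal X) (O : set (Z I)) F : open O -> O F ->
  exists2 S, I S & exists2 e, 0 < e &
    [set G | hausdorff_near (val F) S e (val G)] `<=` O.
Proof.
by move=> oO OF; apply/us_nbhsP; apply: open_nbhs_nbhs.
Qed.

Lemma us_T1 (I : closed_ideal X) : accessible_space (Z I).
Proof.
move=> F G /eqP FG.
have [x [e e0 FGe]] : exists x, exists2 e : R, 0 < e &
    ~ hausdorff_near (val F) [set x] e (val G).
  by apply: hausdorff_near_sep; [exact: us_usco..|move=> /us_inj].
exists ([set H | hausdorff_near (val F) [set x] e (val H)] : set (Z I))^°.
split; first exact: open_interior.
  by apply/mem_set; apply: us_nbhs_near => //; exact: ideal_set1.
by apply/mem_set => /interior_subset.
Qed.

Lemma ideal_compl1_open (I : closed_ideal X) (x : X) : open (~` [set x]).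
Proof. by apply: closed_openC; apply: (ideal_closed (ideal_set1 I x)). Qed.

Lemma ideal_point_notin (I : closed_ideal X) S : I S -> exists p, ~ S p.
Proof.
move=> IS; apply: contrapT => /forallNP nS; apply: (@ideal_proper _ I).
rewrite -(_ : S = setT) //; apply/seteqP; split=> // x _.
exact: contrapT (nS x).
Qed.

Lemma nbhds_set_compl1 (J : closed_ideal X) (S : set X) p : J S -> ~ S p ->
  nbhds_set S (~` [set p]).
Proof.
move=> JS nSp; split; last by move=> x Sx xp; apply: nSp; rewrite -xp.
split; first exact: ideal_compl1_open J p.
  by have [s Ss] := ideal_neq0 JS; exists s => sp; apply: nSp; rewrite -sp.
by move=> /seteqP[_ /(_ p I)]; apply.
Qed.

(** The map [(1 - g) F + c g], where [g] is [0] on [S] and [1] outside of [U] *)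
Lemma us_bump (F : us_sort E) S U (c : R) : A S -> open U -> S `<=` U ->
  exists2 G, forall e, 0 < e -> hausdorff_near (val F) S e (val G) &
    forall x, ~ U x -> val G x = [set c].
Proof.
move=> AS oU SU; have [g [cg g0 g1]] := normalA AS oU SU.
pose phi (p : X * R) := (1 - g p.1) * p.2 + c * g p.1.
have cphi : continuous phi.
  move=> p; have cg1 : g q.1 @[q --> p] --> g p.1.
    by apply: continuous_comp; [exact: cvg_fst|exact: cg].
  apply: cvgD; last by apply: cvgM => //; exact: cvg_cst.
  by apply: cvgM; [apply: cvgB => //; exact: cvg_cst|exact: cvg_snd].
have [G GE] := us_image F cphi; exists G => [e e0 x Sx|x nUx]; rewrite GE.
  have phiE y : phi (x, y) = y.
    by rewrite /phi /= g0 // subr0 mul1r mulr0 addr0.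
  split=> [y Fy|_ [y Fy <-]]; exists y; rewrite ?phiE ?subrr ?normr0 //.
  by exists y.
have phiE y : phi (x, y) = c.
  by rewrite /phi /= g1 // subrr mul0r mulr1 add0r.
apply/seteqP; split=> [_ [y _ <-]|_ ->]; first exact: phiE.
by have [y Fy] := us_val_neq0 F x; exists y.
Qed.

Lemma not_ideal_covers (U : nat -> set X) : (forall n, proper_opens X (U n)) ->
  ~ ideal_covers B (range U) -> exists2 S, B S & forall n, ~ S `<=` U n.
Proof.
move=> pU ncov; apply: contrapT => nS; apply: ncov.
have cov S : B S -> exists2 V, range U V & S `<=` V.
  move=> BS; apply: contrapT => nV; apply: nS; exists S => // n SU.
  by apply: nV; exists (U n).
split=> //.
- by move=> _ [n _ <-]; have [] := pU n.
- apply/seteqP; split=> // x _.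
  by have [V UV xV] := cov _ (ideal_set1 B x); exists V => //; exact: xV.
- by move=> [n _ Un]; have [_ []] := pU n; rewrite Un.
- by move=> [n _ Un]; have [_ _] := pU n; rewrite Un.
Qed.

(** Enlarge [S] by a point outside of each of the first [k] terms: a term that
    contains the enlarged set comes later. *)
Lemma ideal_covers_late (U : nat -> set X) S k :
  (forall n, U n <> setT) -> ideal_covers B (range U) -> B S ->
  exists2 n, (k <= n)%N & S `<=` U n.
Proof.
move=> UT [_ _ _ _ cov] BS.
have /choice[p pP] n : exists p, ~ U n p.
  apply: contrapT => /forallNP nU; apply: (UT n); apply/seteqP; split=> // x _.
  exact: contrapT (nU x).
suff [T [BT ST pT]] : exists T, [/\ B T, S `<=` T &
    forall n, (n < k)%N -> T (p n)].
  have [_ [n _ <-] TU] := cov T BT; exists n; last exact: subset_trans TU.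
  by rewrite leqNgt; apply/negP => /pT /TU; exact: pP.
elim: k => [|k [T [BT ST pT]]]; first by exists S; split.
exists (T `|` [set p k]); split.
- by apply: ideal_setU => //; exact: ideal_set1.
- by move=> x /ST; left.
- by move=> n; rewrite ltnS leq_eqVlt => /orP[/eqP ->|/pT]; [right|left].
Qed.

(** Legality of the moves of One: the constant map [1] is not in this
    neighbourhood of [0], and the interior is taken because a Hausdorff ball
    needs not be open. *)
Lemma zero_nbhds_pt (S : set X) (e : R) : A S -> 0 < e -> e <= 1 ->
  nbhds_pt (zero : Z A)
    ([set G | hausdorff_near (val zero) S e (val G)] : set (Z A))^°.
Proof.
move=> AS e0 e1.
have zN := us_nbhs_near zero AS e0.
split; last exact: zN.
split; [exact: open_interior|by exists zero|].
have cphi : continuous (fun _ : X * R => 1 : R) by exact: cst_continuous.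
have [G GE] := us_image zero cphi.
move=> /seteqP[_ /(_ G I) /interior_subset]; rewrite /= us_zeroE.
move=> /(hausdorff_near0 _ _ (us_val_neq0 G)) nearG.
have [s Ss] := ideal_neq0 AS.
have : `|1| < e.
  by apply: (nearG s) => //; rewrite GE; exists 0; rewrite ?us_zeroE.
by rewrite normr1 ltNge e1.
Qed.

Lemma proper_moves_neq0 :
  \bigcup_(M in proper_opens (Z A)) M !=set0.
Proof.
have [pO Oz] := zero_nbhds_pt (ideal_set1 A x0) ltr01 (lexx 1).
by exists zero; eexists; first exact: pO.
Qed.

Lemma cover_le_discrete :
  game_le (G1 (nbhds_ideal A) (~` ideal_covers B))
          (G1 (proper_opens (Z A)) (closed_discrete (Z B))).
Proof.
pose W n (U : set X) (H : us_sort E) :=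
  proper_opens X U /\ forall x, ~ U x -> val H x = [set n%:R].
apply: (@game_le_translation (G1 _ _) (G1 _ _) W) => /=.
- exact: proper_moves_neq0.
- move=> n O [oO [F OF] _].
  have [S AS [e e0 SO]] := us_open_near oO OF.
  exists (nbhds_set S); first by exists S.
  move=> U [pU SU]; have [oU _ _] := pU.
  have [G GS GU] := us_bump F n%:R AS oU SU.
  by exists G => //; apply: SO; exact: GS.
- move=> U H WUH ncov.
  have pU n : proper_opens X (U n) by have [] := WUH n.
  have [S BS nSU] := not_ideal_covers pU ncov.
  apply: closed_discrete_locally_finite; first exact: us_T1.
  move=> F; exists [set G | hausdorff_near (val F) S 1 (val G)].
    exact: us_nbhs_near.
  have [M MF] := usco_bounded (us_usco F) (seqB BS).
  have M0 : 0 <= M.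
    have [s Ss] := ideal_neq0 BS; have [y Fy] := us_val_neq0 F s.
    exact: le_trans (MF s y Ss Fy).
  apply: (sub_finite_set _ (finite_II (Num.bound (M + 1)))) => n /= HnF.
  have [x Sx nUx] : exists2 x, S x & ~ U n x.
    by apply: contrapT => nx; apply: (nSU n) => x Sx; apply: contrapT => nUx;
      apply: nx; exists x.
  have [_ Hn] := WUH n; have [_] := HnF x Sx; rewrite Hn //.
  move=> /(_ n%:R erefl)[y /(MF _ _ Sx) yM ny].
  have n_le : n%:R < M + 1.
    have := ler_normD (n%:R - y) y; rewrite subrK normr_nat; lra.
  rewrite -(ltr_nat R); apply: lt_trans n_le _.
  by apply: archi_boundP; lra.
Qed.

Lemma discrete_le_closure :
  game_le (G1 (proper_opens (Z A)) (closed_discrete (Z B)))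
          (G1 (proper_opens (Z A)) (~` Omega (zero : Z B))).
Proof.
pose W (n : nat) (F G : us_sort E) := F = G /\ F <> zero.
apply: (@game_le_translation (G1 _ _) (G1 _ _) W) => /=.
- exact: proper_moves_neq0.
- move=> n O [oO [F OF] OT]; exists (O `&` ~` [set zero]).
    split.
    + apply: openI => //; apply: closed_openC.
      by apply: accessible_closed_set1; exact: us_T1.
    + have [Fz|nFz] := pselect (F = zero); last by exists F.
      (* [0] is not isolated: [G] is close to it on [S] with the value [1]
         at [p]. *)
      have [S AS [e e0 SO]] := us_open_near oO OF.
      have [p nSp] := ideal_point_notin AS.
      have [[oU _ _] SU] := nbhds_set_compl1 AS nSp.
      have [G GS Gp] := us_bump F 1 AS oU SU.
      exists G; split; first by apply: SO; exact: GS.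
      move=> Gz; have := Gp p; rewrite Gz us_zeroE => /(_ (fun h => h erefl)).
      by move=> /seteqP[/(_ 0 erefl) /esym/eqP]; rewrite oner_eq0.
    + by move=> OzT; apply: OT; apply/seteqP; split=> // G _;
        have : [set: us_sort E] G by []; rewrite -OzT => -[].
  by move=> G [OG Gz]; exists G.
- move=> F G FG [clF _] clG.
  have FGE : range G = range F.
    by congr (_ @` _); apply/funext => n; have [] := FG n.
  have : range F zero by apply: clF; rewrite -FGE.
  by move=> [n _]; have [] := FG n.
Qed.

Lemma closure_le_zero :
  game_le (G1 (proper_opens (Z A)) (~` Omega (zero : Z B)))
          (G1 (nbhds_pt (zero : Z A)) (~` Omega (zero : Z B))).
Proof.
pose W (n : nat) (F G : us_sort E) := F = G.
apply: (@game_le_translation (G1 _ _) (G1 _ _) W) => /=.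
- exists zero; have zO := zero_nbhds_pt (ideal_set1 A x0) ltr01 (lexx 1).
  by eexists; [exact: zO|exact: zO.2].
- by move=> n O [pO _]; exists O => // F OF; exists F.
- by move=> F G FG; rewrite (_ : F = G) //; apply/funext.
Qed.

Lemma zero_le_cover :
  game_le (G1 (nbhds_pt (zero : Z A)) (~` Omega (zero : Z B)))
          (G1 (nbhds_ideal A) (~` ideal_covers B)).
Proof.
pose W n (F : us_sort E) (U : set X) :=
  U <> setT /\ forall x y, U x -> val F x y -> `|y| < n.+1%:R^-1.
have n0 n : 0 < n.+1%:R^-1 :> R by rewrite invr_gt0.
apply: (@game_le_translation (G1 _ _) (G1 _ _) W) => /=.
- have [p px0] := ideal_point_notin (ideal_set1 A x0).
  exists (~` [set p]), (nbhds_set [set x0]).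
    by exists [set x0] => //; exact: ideal_set1.
  exact: nbhds_set_compl1 (ideal_set1 A x0) px0.
- move=> n _ [S AS <-].
  exists ([set G | hausdorff_near (val zero) S n.+1%:R^-1 (val G)]
      : set (Z A))^°.
    by apply: zero_nbhds_pt => //; rewrite invf_le1 // ler1n.
  move=> F /interior_subset /=; rewrite us_zeroE.
  move=> /(hausdorff_near0 _ _ (us_val_neq0 F)) nearF.
  have [p nSp] := ideal_point_notin AS.
  have [[oU U0 UT] SU] := nbhds_set_compl1 AS nSp.
  (* A point is removed in case the values of [F] are small on all of [X]. *)
  pose V := [set x | val F x `<=` ball 0 n.+1%:R^-1] `&` ~` [set p].
  have [_ _ uF] := us_usco F.
  have SV : S `<=` V.
    move=> x Sx; split; last exact: SU.
    by move=> y Fxy; rewrite /ball /= sub0r normrN; exact: nearF Sx Fxy.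
  have VT : V <> setT by move=> /seteqP[_ /(_ p I)[_]]; apply.
  exists V.
    split=> //; split=> //; first by apply: openI => //; apply/uF/ball_open.
    by have [s Ss] := ideal_neq0 AS; exists s; exact: SV.
  by split=> // x y [xV _] /xV; rewrite /ball /= sub0r normrN.
- move=> F U FU clF cov; apply: clF => N /us_nbhsP[S BS [e e0 SN]].
  have [k ke] : exists k, k.+1%:R^-1 < e.
    exists (Num.bound e^-1); rewrite invf_plt ?posrE //.
    apply: lt_trans (archi_boundP _) _; first by rewrite invr_ge0 ltW.
    by rewrite ltr_nat.
  have UT n : U n <> setT by have [] := FU n.
  have [n kn SU] := ideal_covers_late k UT cov BS.
  exists (F n); split; first by exists n.
  apply: SN => /=; rewrite us_zeroE.
  apply/(hausdorff_near0 _ _ (us_val_neq0 (F n))) => x y Sx Fxy.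
  have [_ /(_ x y (SU x Sx) Fxy) yn] := FU n.
  apply: lt_trans yn (le_lt_trans _ ke).
  by rewrite lef_pV2 ?posrE // ler_nat.
Qed.

End Translations.

Lemma us_games_equiv (R : realType) (X : topologicalType)
    (E : usco_space R X) (A B : closed_ideal X) :
  functionally_normal R A ->
  (forall S : set X, B S -> sequentially_compact S) ->
  [/\ G1 (nbhds_ideal A) (~` ideal_covers B) ≡
        G1 (nbhds_pt (us_zero E : us_top E A))
           (~` Omega (us_zero E : us_top E B)),
      G1 (nbhds_ideal A) (~` ideal_covers B) ≡
        G1 (proper_opens (us_top E A)) (~` Omega (us_zero E : us_top E B)) &
      G1 (nbhds_ideal A) (~` ideal_covers B) ≡
        G1 (proper_opens (us_top E A)) (closed_discrete (us_top E B))].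
Proof.
move=> normalA seqB; have [[x0 _]|X0] := pselect ([set: X] !=set0).
  have cd := cover_le_discrete E x0 normalA seqB.
  have dc := discrete_le_closure E B x0 normalA.
  have cz := closure_le_zero E A B x0.
  have zc := zero_le_cover E A B x0.
  have cc := game_le_trans cd dc; have cz' := game_le_trans cc cz.
  have dz := game_le_trans dc cz.
  split; apply: game_le_equiv => //.
  - exact: game_le_trans cz zc.
  - exact: game_le_trans dz zc.
have ideal0 : nbhds_ideal A = set0.
  apply/seteqP; split=> // M [S AS _].
  by have [s _] := ideal_neq0 AS; apply: X0; exists s.
have proper0 : proper_opens (us_top E A) = set0.
  apply/seteqP; split=> // U [_ [F UF] UT]; apply: UT.
  apply/seteqP; split=> // G _; rewrite (_ : G = F) //.
  by apply: us_inj; apply/funext => x; case: X0; exists x.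
have nbhds0 : nbhds_pt (us_zero E : us_top E A) = set0.
  by apply/seteqP; split=> // U []; rewrite proper0.
by split; apply: game_equiv_no_moves => //=; try exact: set0; exact: us_zero.
Qed.

(** * Minimal usco maps and continuous functions *)

Section Instances.
Variables (R : realType) (X : topologicalType).

Lemma MU_inj : injective (@mu_map R X).
Proof.
move=> [F minF] [G minG] /= FG; move: minF minG; rewrite FG => minF minG.
by congr MkMU; exact: Prop_irrelevance.
Qed.

Lemma MU_image (phi : X * R -> R) (F : MU R X) : continuous phi ->
  exists G : MU R X, mu_map G = fibre_image phi F.
Proof.
by move=> cphi; exists (MkMU (minimal_usco_fibre_image cphi (mu_minimal F))).
Qed.

Lemma MU_nbhsP (I : closed_ideal X) (x0 : X) (F : MU_space R I)
    (N : set (MU_space R I)) :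
  nbhs F N <-> exists2 A, I A & exists2 e : R, 0 < e &
    [set G : MU_space R I | hausdorff_near (mu_map F) A e (mu_map G)] `<=` N.
Proof.
split=> [|[A IA [e e0 FN]]].
  rewrite nbhsE => -[] O [oO OF] ON.
  have [A IA [e e0 FO]] := (MU_openP x0 O).1 oO F OF.
  by exists A => //; exists e => // G /FO /ON.
(* The ball need not be open, but contains the open set of all its points that
   are the centre of some ball inside [N]. *)
pose O : set (MU_space R I) := [set G | exists2 e : R, 0 < e &
  [set H : MU_space R I | hausdorff_near (mu_map G) A e (mu_map H)] `<=` N].
have OF : O F by exists e.
have ON : O `<=` N.
  move=> G [d d0]; apply => x _.
  by split=> y Gy; exists y; rewrite // subrr normr0.
rewrite nbhsE; exists O => //; split=> //; apply/(MU_openP x0) => G [d d0 GN].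
exists A => //; exists (d / 2); first by rewrite divr_gt0.
move=> H GH; exists (d / 2); first by rewrite divr_gt0.
move=> K HK; apply: GN => /=; rewrite (splitr d).
exact: hausdorff_near_trans GH HK.
Qed.

Definition MU_usco_space : usco_space R X :=
  @UscoSpace R X (MU R X) (@mu_map R X) (MU0 R X)
    (fun I => Topological.on (MU_space R I))
    (fun F => (mu_minimal F).1) MU_inj erefl MU_image
    MU_nbhsP.

Definition C_val (f : continuousType X R) : X -> set R :=
  fun x => [set (f : X -> R) x].

Lemma C_usco (f : continuousType X R) : usco (C_val f).
Proof.
rewrite (_ : C_val f = fibre_image (fun p : X * R => (f : X -> R) p.1)
  (fun=> [set 0])).
  apply: usco_fibre_image (minimal_usco0 R X).1 => p.
  by apply: continuous_comp; [exact: cvg_fst|exact: cts_fun].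
by apply/funext => x; rewrite /fibre_image image_set1.
Qed.

Lemma C_inj : injective C_val.
Proof.
move=> f g fg; apply/continuousEP => x.
by have := congr1 (@^~ x) fg => /seteqP[/(_ _ erefl)].
Qed.

Lemma C_image (phi : X * R -> R) (f : continuousType X R) : continuous phi ->
  exists g, C_val g = fibre_image phi (C_val f).
Proof.
move=> cphi; have cg : continuous (fun x => phi (x, (f : X -> R) x)).
  move=> x; apply: (@continuous_comp X (X * R)%type R
    (fun x => (x, (f : X -> R) x)) phi x); last exact: cphi.
  apply: (@cvg_pair _ _ _ (nbhs x) (nbhs x) (nbhs ((f : X -> R) x))).
    exact: cvg_id.
  exact: cts_fun.
exists (mkcts cg); apply/funext => x.
by rewrite /fibre_image /C_val image_set1.
Qed.

Lemma C_near_nbhsP (I : closed_ideal X) (x0 : X) (f : C_space R I)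
    (N : set (C_space R I)) :
  nbhs f N <-> exists2 A, I A & exists2 e : R, 0 < e &
    [set g : C_space R I | hausdorff_near (C_val f) A e (C_val g)] `<=` N.
Proof.
rewrite (C_nbhsP x0); split=> -[A IA [e e0 fN]]; exists A => //; exists e => //.
  by move=> g /hausdorff_near_cst; exact: fN.
by move=> g fg; apply: fN; apply/hausdorff_near_cst.
Qed.

Definition C_usco_space : usco_space R X :=
  @UscoSpace R X (continuousType X R) C_val (C0 R X)
    (fun I => Topological.on (C_space R I))
    C_usco C_inj erefl C_image C_near_nbhsP.

End Instances.

Theorem corollary40 (R : realType) (X : topologicalType)
    (A B : closed_ideal X)
    (hA : functionally_normal R A)
    (hB : forall S : set X, B S -> sequentially_compact S) :
  (G1 (nbhds_ideal A) (~` ideal_covers B) ≡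
   G1 (nbhds_pt (MU0 R X : MU_space R A))
      (~` Omega (MU0 R X : MU_space R B))) /\
  (G1 (nbhds_pt (MU0 R X : MU_space R A))
      (~` Omega (MU0 R X : MU_space R B)) ≡
   G1 (nbhds_pt (C0 R X : C_space R A))
      (~` Omega (C0 R X : C_space R B))) /\
  (G1 (nbhds_pt (C0 R X : C_space R A))
      (~` Omega (C0 R X : C_space R B)) ≡
   G1 (proper_opens (MU_space R A))
      (~` Omega (MU0 R X : MU_space R B))) /\
  (G1 (proper_opens (MU_space R A))
      (~` Omega (MU0 R X : MU_space R B)) ≡
   G1 (proper_opens (C_space R A))
      (~` Omega (C0 R X : C_space R B))) /\
  (G1 (proper_opens (C_space R A))
      (~` Omega (C0 R X : C_space R B)) ≡
   G1 (proper_opens (MU_space R A)) (closed_discrete (MU_space R B))) /\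
  (G1 (proper_opens (MU_space R A)) (closed_discrete (MU_space R B)) ≡
   G1 (proper_opens (C_space R A)) (closed_discrete (C_space R B))).
Proof.
have [MUz MUc MUd] := us_games_equiv (MU_usco_space R X) hA hB.
have [Cz Cc Cd] := us_games_equiv (C_usco_space R X) hA hB.
have via G H K : G ≡ H -> G ≡ K -> H ≡ K.
  by move=> /game_equiv_sym; exact: game_equiv_trans.
split; first exact: MUz.
split; first exact: via MUz Cz.
split; first exact: via Cz MUc.
split; first exact: via MUc Cc.
split; first exact: via Cc MUd.
exact: via MUd Cd.
Qed.
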